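(* Let $d\ge 3$ be an integer. There exists a set $Z\subset\mathbb{R}$ of Lebesgue measure $0$ such that for every function $\varepsilon\colon\mathbb{N}\to(0,\infty)$ with $\frac{\log (1/\varepsilon(n))}{\log n}\to 0$ as $n\to\infty$ and every $\alpha\in\mathbb{R}\setminus Z$, the set $$\{n\in\mathbb{N} : \|\alpha n^d\|_{\mathbb{R}/\mathbb{Z}}\le\varepsilon(n)\}$$ is a basis of order $2$.
   Context: $\mathbb{N}=\{0,1,2,\dots\}$ and $\|t\|_{\mathbb{R}/\mathbb{Z}}=\min_{n\in\mathbb{Z}}|t-n|$. A set $\mathcal{A}\subset\mathbb{N}$ is a basis of order $2$ if $2\mathcal{A}=\{n_1+n_2 : n_1,n_2\in\mathcal{A}\}$ contains all sufficiently large integers. *)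

(* Defs.v *)
From mathcomp Require Import all_boot all_order all_algebra.
From mathcomp Require Import all_classical all_reals all_analysis.
Set Implicit Arguments.
Unset Strict Implicit.
Unset Printing Implicit Defensive.
Import Order.TTheory GRing.Theory Num.Theory.
Import numFieldNormedType.Exports.
Local Open Scope classical_set_scope.
Local Open Scope ring_scope.

(* The infimum is a minimum: see [distZ_min] below. *)
Definition distZ (R : realType) (t : R) : R :=
  inf [set `|t - m%:~R| | m in [set: int]].

Lemma distZ_min (R : realType) (t : R) :
  (exists m : int, distZ t = `|t - m%:~R|) /\
  (forall m : int, distZ t <= `|t - m%:~R|).
Proof.
have lb : has_inf [set `|t - m%:~R| | m in [set: int]].
  by split; [exists `|t - 0%:~R|, 0 | exists 0 => _ [m _ <-]].
have le_m (m : int) : distZ t <= `|t - m%:~R|.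
  by apply: ge_inf; [exact: lb.2 | exists m].
split=> //.
set f := Num.floor t.
have f_le : f%:~R <= t by exact: floor_le.
have t_lt : t < (f + 1)%:~R by exact: floorD1_gt.
pose c := Num.min `|t - f%:~R| `|t - (f + 1)%:~R|.
have c_le (m : int) : c <= `|t - m%:~R|.
  have [m_le|f_lt] := leP m f.
    rewrite ge_min; apply/orP; left.
    have mf : m%:~R <= f%:~R :> R by rewrite ler_int.
    by rewrite !ger0_norm ?subr_ge0 ?lerD2l ?lerN2 // (le_trans mf).
  rewrite ge_min; apply/orP; right.
  have fm : (f + 1)%:~R <= m%:~R :> R by rewrite ler_int lezD1.
  rewrite (distrC t) (distrC t m%:~R) !ger0_norm ?subr_ge0 ?lerD2r //.
    by rewrite (le_trans (ltW t_lt)).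
  exact: ltW.
have cE : distZ t = c.
  apply/eqP; rewrite eq_le; apply/andP; split.
    by rewrite le_min !le_m.
  by apply: lb_le_inf; [exact: lb.1 | move=> _ [m _ <-]].
rewrite cE /c; case: leP => _; [by exists f | by exists (f + 1)].
Qed.

Definition sumset (A B : set nat) : set nat :=
  [set (a + b)%N | a in A & b in B].

Definition basis_of_order2 (A : set nat) : Prop :=
  \forall n \near \oo, sumset A A n.

(* Main.v *)
Require Import Defs.
From mathcomp Require Import all_boot all_order all_algebra.
From mathcomp Require Import all_classical all_reals all_analysis.
From mathcomp Require Import measurable_realfun.
From mathcomp Require Import ring lra zify.
Set Implicit Arguments.
Unset Strict Implicit.
Unset Printing Implicit Defensive.
Import Order.TTheory GRing.Theory Num.Theory.
Import numFieldNormedType.Exports.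
Local Open Scope classical_set_scope.
Local Open Scope ring_scope.

(** Write [e(t) = exp (2 pi i t)]. Fix [N], and let [n] run over [L <= n < 2 L] with
    [L = N / 3]. A trigonometric polynomial [P] in [x = alpha n^d] and
    [y = alpha (N - n)^d], with frequencies at most [J], has large constant term and
    is positive only if [x] and [y] are within [O (J^(-1/2))] of an integer.
    Hence, if no [n] works, then one of the sums [sum_n e (k x + l y)],
    [(k, l) != 0], [|k|, |l| <= J], is at least [L / (7 J^3)] in absolute value.
    The fourth moment over [alpha] of such a sum counts the solutions of
    [g n1 - g n2 = g n3 - g n4] for [g n = k n^d + l (N - n)^d]. Since [d >= 3],
    [g] has degree at least 2 (the degree drops to [d - 1] when the leading terms
    cancel); as [a - b] divides [g a - g b], the divisor bound leaves
    [O (J N^2)] solutions. With [J = N^(1/30)] the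
    measure of the bad [alpha] is [O (N^(-3/2))], and Borel-Cantelli applies. Every
    admissible [eps] eventually exceeds the power of [N] obtained. *)

(** * The divisor bound *)

(** A divisor [e] of [m * n] is [gcdn e m] times a divisor of [n]. *)
Lemma size_divisorsM (m n : nat) : (0 < m)%N -> (0 < n)%N ->
  (size (divisors (m * n)) <= size (divisors m) * size (divisors n))%N.
Proof.
move=> m0 n0.
rewrite -(size_allpairs muln); apply: uniq_leq_size (divisors_uniq _) _ => e.
rewrite -dvdn_divisors ?muln_gt0 ?m0 // => e_mn.
have g0 : (0 < gcdn e m)%N by rewrite gcdn_gt0 m0 orbT.
have eE : e = (gcdn e m * (e %/ gcdn e m))%N by rewrite mulnC divnK ?dvdn_gcdl.
rewrite eE; apply: allpairs_f; rewrite -dvdn_divisors ?dvdn_gcdr //.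
have co : coprime (e %/ gcdn e m) (m %/ gcdn e m).
  rewrite /coprime -(eqn_pmul2l g0) muln1 muln_gcdr.
  by rewrite !(mulnC (gcdn e m)) !divnK ?dvdn_gcdl ?dvdn_gcdr.
rewrite -(Gauss_dvdr _ co) -(dvdn_pmul2l g0) -eE mulnA.
by rewrite (mulnC (gcdn e m)) divnK ?dvdn_gcdr.
Qed.

Lemma size_divisors_pfactor (p a : nat) : prime p ->
  (size (divisors (p ^ a)) <= a.+1)%N.
Proof.
move=> p_pr; rewrite -[a.+1](size_iota 0) -(size_map (expn p) (iota _ _)).
apply: uniq_leq_size (divisors_uniq _) _ => e.
rewrite -dvdn_divisors ?expn_gt0 ?prime_gt0 // => /(dvdn_pfactor _ _ p_pr)[i ia ->].
by apply: map_f; rewrite mem_iota.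
Qed.

(** The cost of one prime power in the divisor bound. With [q] the quotient of [a + 1] by [K],
    [a + 1 <= K * (q + 1) <= K * 2 ^ q], and [(2 ^ q) ^ K <= 2 ^ (a + 1)]. *)
Lemma expn_succ_le (K a : nat) : (0 < K)%N ->
  (a.+1 ^ K <= 2 * K ^ K * 2 ^ a)%N.
Proof.
move=> K0.
have a1 : (a.+1 <= K * 2 ^ (a.+1 %/ K))%N.
  apply: leq_trans (_ : K * (a.+1 %/ K).+1 <= _)%N; last first.
    by rewrite leq_mul2l ltn_expl ?orbT.
  by rewrite mulnC ltnW // ltn_ceil.
apply: leq_trans (_ : (K * 2 ^ (a.+1 %/ K)) ^ K <= _)%N.
  by rewrite leq_exp2r.
rewrite expnMn -expnM -mulnA mulnCA leq_mul2l -expnS leq_exp2l //.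
by rewrite leq_divM orbT.
Qed.

(** Induction on [b], splitting off the power of [b] when [b] is prime. A prime below [2 ^ K] costs
    a factor [2 * K ^ K]; a larger prime [p] costs nothing, as
    [(a + 1) ^ K <= 2 ^ (K * a) <= p ^ a]. The cap [2 ^ K] in the exponent makes the constant
    uniform in [v]. *)
Lemma size_divisors_smooth (K b v : nat) : (0 < K)%N -> (0 < v)%N ->
  (forall p, prime p -> p %| v -> p < b)%N ->
  (size (divisors v) ^ K <= (2 * K ^ K) ^ minn b (2 ^ K) * v)%N.
Proof.
move=> K0; elim: b v => [|b IHb] v v0 smooth.
  have -> : v = 1%N.
    apply/eqP; rewrite eqn_leq v0 andbT leqNgt; apply/negP => v1.
    by have := smooth _ (pdiv_prime v1) (pdiv_dvd v).
  by rewrite min0n expn0 /= exp1n.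
have c0 : (0 < 2 * K ^ K)%N by rewrite muln_gt0 expn_gt0 K0.
have minS : ((2 * K ^ K) ^ minn b (2 ^ K) <= (2 * K ^ K) ^ minn b.+1 (2 ^ K))%N.
  by rewrite leq_pexp2l //; lia.
have [b_pr|b_npr] := boolP (prime b); last first.
  apply: leq_trans (IHb _ v0 _) _; last by rewrite leq_mul2r minS orbT.
  move=> p p_pr pv; have := smooth _ p_pr pv; rewrite ltnS leq_eqVlt.
  by case/orP => // /eqP pb; rewrite -pb p_pr in b_npr.
have [m bm vE] := pfactor_coprime b_pr v0.
have m0 : (0 < m)%N by case: m vE {bm} => // vE; rewrite vE in v0.
set a := logn b v in vE.
have {}IHb : (size (divisors m) ^ K <= (2 * K ^ K) ^ minn b (2 ^ K) * m)%N.
  apply: IHb => // p p_pr pm.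
  have := smooth _ p_pr; rewrite vE dvdn_mulr // ltnS leq_eqVlt => /(_ isT).
  case/orP => [/eqP pb|//]; exfalso.
  by move: bm; rewrite prime_coprime // -pb pm.
have step : (a.+1 ^ K * (2 * K ^ K) ^ minn b (2 ^ K)
    <= (2 * K ^ K) ^ minn b.+1 (2 ^ K) * b ^ a)%N.
  have [bK|Kb] := ltnP b (2 ^ K).
    have -> : (minn b.+1 (2 ^ K) = b.+1)%N by lia.
    rewrite expnS mulnC mulnAC [leqRHS]mulnC leq_mul2l; apply/orP; right.
    apply: leq_trans (expn_succ_le _ K0) _.
    rewrite leq_mul2l; apply/orP; right.
    by case: (posnP a) => [->//|a0]; rewrite leq_exp2r // prime_gt1.
  have -> : (minn b.+1 (2 ^ K) = 2 ^ K)%N by lia.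
  rewrite mulnC leq_mul2l; apply/orP; right.
  apply: leq_trans (_ : (2 ^ K) ^ a <= _)%N.
    by rewrite -expnM mulnC expnM leq_exp2r // ltn_expl.
  by case: (posnP a) => [->//|a0]; rewrite leq_exp2r.
rewrite {1}vE [X in divisors X]mulnC.
apply: leq_trans (_ : (size (divisors (b ^ a)) * size (divisors m)) ^ K <= _)%N.
  by rewrite leq_exp2r // size_divisorsM // expn_gt0 prime_gt0.
rewrite expnMn.
apply: leq_trans (_ : a.+1 ^ K * ((2 * K ^ K) ^ minn b (2 ^ K) * m) <= _)%N.
  by apply: leq_mul => //; rewrite leq_exp2r // size_divisors_pfactor.
by rewrite [in leqRHS]vE (mulnC m) !mulnA leq_mul2r step orbT.
Qed.

Lemma size_divisors_bound (K : nat) : (0 < K)%N ->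
  exists2 C : nat, (0 < C)%N &
    forall v, (0 < v)%N -> (size (divisors v) ^ K <= C * v)%N.
Proof.
move=> K0; have c0 : (0 < 2 * K ^ K)%N by rewrite muln_gt0 expn_gt0 K0.
exists ((2 * K ^ K) ^ (2 ^ K))%N => [|v v0]; first by rewrite expn_gt0 c0.
apply: leq_trans (@size_divisors_smooth K v.+1 v K0 v0 _) _.
  by move=> p _ /dvdn_leq; rewrite ltnS; exact.
by rewrite leq_mul2r leq_pexp2l ?orbT //; lia.
Qed.

(** * Additive energy of polynomial values *)

(** Otherwise [G] is affine along the multiples of [h], so [G \Po (h *: 'X)] has degree at most 1,
    and so has [G]. *)
Lemma comp_polyD_sub_neq0 (G : {poly int}) (h v : int) :
  (2 < size G)%N -> h != 0 -> G \Po ('X + h%:P) - G - v%:P != 0.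
Proof.
move=> G3 h0; apply/eqP => G0.
have shift x : G.[x + h] = G.[x] + v.
  have := congr1 (fun p => p.[x]) G0.
  rewrite !hornerE horner_comp !hornerE => /eqP.
  by rewrite subr_eq0 subr_eq => /eqP ->; rewrite addrC.
have lin (n : nat) : G.[h * n%:Z] = G.[0] + v * n%:Z.
  elim: n => [|n IHn]; first by rewrite !mulr0 addr0.
  by rewrite -addn1 PoszD mulrDr mulr1 shift IHn mulrDr mulr1 addrA.
pose Q := G \Po (h *: 'X) - (G.[0]%:P + v *: 'X).
have [Q0|Q_neq0] := eqVneq Q 0; last first.
  (* [Q] vanishes at [size Q] distinct integers, more than its degree allows. *)
  have := @max_poly_roots _ Q (map Posz (iota 0 (size Q))) Q_neq0 _ _.
  rewrite size_map size_iota ltnn => abs.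
  suff: false by []; apply: abs.
    apply/allP => _ /mapP[n _ ->]; apply/rootP.
    by rewrite /Q !hornerE horner_comp !hornerE lin subrr.
  by rewrite map_inj_uniq ?iota_uniq // => m n [].
have : size (G \Po (h *: 'X)) = size G.
  by rewrite size_comp_poly2 // size_scale // size_polyX.
have -> : G \Po (h *: 'X) = G.[0]%:P + v *: 'X.
  by apply/eqP; rewrite -subr_eq0 -/Q Q0.
move=> sz; move: G3; rewrite -sz ltnNge => /negP; apply.
apply: leq_trans (size_polyD _ _) _; rewrite geq_max.
rewrite (leq_trans (size_polyC_leq1 _)) //=.
by rewrite (leq_trans (size_scale_leq _ _)) // size_polyX.
Qed.

Lemma card_pairs (I : finType) (P : I -> I -> bool) :
  #|[pred p : I * I | P p.1 p.2]| = (\sum_j #|[pred i | P i j]|)%N.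
Proof.
under eq_bigr do rewrite -sum1_card.
by rewrite (exchange_big_dep predT) //= pair_big_dep /= -sum1_card.
Qed.

Lemma sum_bool_count (T : Type) (r : seq T) (a : pred T) :
  (\sum_(i <- r) a i = count a r)%N.
Proof. by rewrite -sum1_count [RHS]big_mkcond. Qed.

Lemma dvdz_sub_horner (G : {poly int}) (a b : int) : (a - b %| G.[a] - G.[b])%Z.
Proof.
have /factor_theorem[q qE] : root (G - G.[b]%:P) b by rewrite rootE !hornerE subrr.
have := congr1 (fun p => p.[a]) qE; rewrite !hornerE => ->.
exact: dvdz_mull.
Qed.

Section Counting.
Variables (I : finType) (x : I -> int) (G : {poly int}).
Hypothesis x_inj : injective x.

Lemma card_roots_le (p : {poly int}) :
  p != 0 -> (#|[pred i | root p (x i)]| <= size p)%N.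
Proof.
move=> p0; rewrite cardE -(size_map x); apply/ltnW/max_poly_roots => //.
  by apply/allP => _ /mapP[i + ->]; rewrite mem_enum inE.
by rewrite map_inj_uniq // enum_uniq.
Qed.

(** For fixed [j], [x i] is a root of the nonzero polynomial [G - G.[x j]%:P]. *)
Lemma card_level_pairs : (1 < size G)%N ->
  (#|[pred p : I * I | (G.[x p.1] - G.[x p.2] == 0)%R]| <= #|I| * size G)%N.
Proof.
move=> G2; rewrite (card_pairs (fun i j => G.[x i] - G.[x j] == 0)) -sum_nat_const.
apply: leq_sum => j _.
have sizeE : size (G - G.[x j]%:P) = size G.
  by rewrite size_polyDl // size_polyN (leq_ltn_trans (size_polyC_leq1 _)).
rewrite -sizeE; apply: leq_trans (card_roots_le _); last first.
  by rewrite -size_poly_gt0 sizeE (ltn_trans _ G2).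
apply/eq_leq/eq_card => i; rewrite !inE rootE; congr (_ == _).
by rewrite !hornerE.
Qed.

(* The difference [x i - x j] divides [G.[x i] - G.[x j]]; once it is fixed,
   [x j] is a root of a nonzero polynomial. *)
Lemma card_difference_pairs (v : int) : (2 < size G)%N -> v != 0 ->
  (#|[pred p : I * I | (G.[x p.1] - G.[x p.2] == v)%R]|
     <= 2 * size (divisors `|v|) * size G)%N.
Proof.
move=> G3 v0.
pose ds := divisors `|v|.
pose hs := map Posz ds ++ map (fun e => - Posz e) ds.
pose Q h := G \Po ('X + h%:P) - G - v%:P.
have ev0 : (0 < `|v|)%N by rewrite absz_gt0.
have ds0 e : e \in ds -> e != 0%N.
  by rewrite -dvdn_divisors // => /dvdn_gt0 -/(_ ev0); rewrite lt0n.
have hs0 h : h \in hs -> h != 0.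
  by rewrite mem_cat => /orP[] /mapP[e /ds0 + ->]; lia.
have hsP h : (h %| v)%Z -> h \in hs.
  move=> hv; rewrite mem_cat; apply/orP.
  have hd : `|h|%N \in ds by rewrite -dvdn_divisors.
  by case: (lerP 0 h) => h0; [left|right]; apply/mapP; exists `|h|%N => //; lia.
have sizeQ h : (size (Q h) <= size G)%N.
  apply: leq_trans (size_polyD _ _) _; rewrite geq_max; apply/andP; split.
    apply: leq_trans (size_polyD _ _) _; rewrite geq_max.
    by rewrite size_comp_poly2 ?size_XaddC // size_polyN leqnn.
  by rewrite size_polyN (leq_trans (size_polyC_leq1 _)) //; lia.
rewrite (card_pairs (fun i j => G.[x i] - G.[x j] == v)).
apply: leq_trans (_ : \sum_j \sum_(h <- hs) root (Q h) (x j) <= _)%N.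
  apply: leq_sum => j _.
  rewrite sum_bool_count cardE -(size_map (fun i => x i - x j)) -size_filter.
  apply: uniq_leq_size => [|h /mapP[i + ->]].
    by rewrite map_inj_uniq ?enum_uniq // => i i' /addIr/x_inj.
  rewrite mem_enum inE mem_filter => /eqP Gij; apply/andP; split.
    rewrite rootE /Q !(hornerD, hornerN, hornerC, horner_comp, hornerX).
    by rewrite (addrC (x j)) subrK Gij subrr.
  by apply: hsP; rewrite -Gij dvdz_sub_horner.
rewrite exchange_big /=.
apply: leq_trans (_ : \sum_(h <- hs) size G <= _)%N; last first.
  rewrite big_const_seq count_predT iter_addn_0 mulnC.
  by rewrite size_cat !size_map addnn -mul2n.
rewrite !big_seq; apply: leq_sum => h /hs0 h0.
apply: leq_trans (sizeQ h); apply: leq_trans (card_roots_le _); last first.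
  exact: comp_polyD_sub_neq0.
by rewrite -sum1_card [leqRHS]big_mkcond.
Qed.

(** Pairs [p] with nonzero difference give the term in [T] through the divisors; if the difference
    is zero, both [p] and [q] are level pairs, which gives [size G ^ 2]. *)
Lemma additive_energy_le (T : nat) (s : int) : (2 < size G)%N -> s != 0 ->
  (forall p : I * I, G.[x p.1] - G.[x p.2] != 0 ->
    (size (divisors `|(s * (G.[x p.1] - G.[x p.2]))%R|) <= T)%N) ->
  (\sum_(p : I * I) #|[pred q : I * I |
      (G.[x q.1] - G.[x q.2] == s * (G.[x p.1] - G.[x p.2]))%R]|
    <= #|I| ^ 2 * (2 * T * size G + size G ^ 2))%N.
Proof.
move=> G3 s0 divT; pose e (p : I * I) := G.[x p.1] - G.[x p.2].
have G2 : (1 < size G)%N by apply: ltnW.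
rewrite (bigID (fun p => e p == 0)) /= addnC mulnDr; apply: leq_add.
  apply: leq_trans (_ : \sum_(p : I * I) 2 * T * size G <= _)%N; last first.
    by rewrite sum_nat_const card_prod mulnn.
  rewrite big_mkcond; apply: leq_sum => p _; case: ifP => // ep.
  apply: leq_trans (card_difference_pairs G3 _) _; first by rewrite mulf_neq0.
  by rewrite leq_mul2r leq_mul2l divT ?orbT.
apply: leq_trans (_ : \sum_(p | e p == 0%R) (#|I| * size G) <= _)%N.
  apply: leq_sum => p /eqP; rewrite /e => ->; rewrite mulr0.
  exact: card_level_pairs.
rewrite sum_nat_const; apply: leq_trans (leq_mul (card_level_pairs G2) (leqnn _)) _.
by rewrite mulnACA !mulnn.
Qed.

End Counting.

(** * The frequency polynomials [k n^d + l (N - n)^d] *)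

Definition shifted_powers (d : nat) (N k l : int) : {poly int} :=
  k *: 'X^d + l *: (N%:P - 'X) ^+ d.

Lemma horner_shifted_powers (d : nat) (N k l x : int) :
  (shifted_powers d N k l).[x] = k * x ^+ d + l * (N - x) ^+ d.
Proof. by rewrite !(hornerD, hornerZ, hornerXn, horner_exp, hornerN, hornerC, hornerX). Qed.

(* The second derivative takes the values [l * N ^+ (d - 2)] at [0] and
   [k * N ^+ (d - 2)] at [N], up to the factor [d * (d - 1)]. *)
Lemma size_shifted_powers_gt2 (d : nat) (N k l : int) : (3 <= d)%N -> N != 0 ->
  (k != 0) || (l != 0) -> (2 < size (shifted_powers d N k l))%N.
Proof.
case: d => [|[|[|d]]] // _ N0 kl; rewrite ltnNge; apply/negP => /derivn_poly0.
rewrite /shifted_powers /= /derivn /= => G''0.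
have dP e : ((N%:P - 'X) ^+ e.+1)^`() = - ((N%:P - 'X) ^+ e *+ e.+1) :> {poly int}.
  by rewrite deriv_exp derivB derivC derivX sub0r mulN1r mulNrn.
have val x : (k * x ^+ d.+1 + l * (N - x) ^+ d.+1) *+ (d.+2 * d.+3) = 0.
  have := congr1 (fun p => p.[x]) G''0.
  rewrite horner0 derivD !derivZ derivXn dP derivD !derivZ derivMn derivXn.
  rewrite derivN derivMn dP mulNrn opprK -!mulrnA.
  rewrite hornerD !hornerZ !hornerMn hornerXn horner_exp hornerD hornerN hornerC hornerX.
  by rewrite !mulrnAr -mulrnDl.
have {}val x : k * x ^+ d.+1 + l * (N - x) ^+ d.+1 = 0.
  by apply/eqP; have /eqP := val x; rewrite mulrn_eq0 muln_eq0.
have := val 0; rewrite expr0n /= mulr0 add0r subr0 => /eqP.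
rewrite mulf_eq0 expf_eq0 (negPf N0) andbF orbF => l0.
have := val N; rewrite subrr expr0n /= mulr0 addr0 => /eqP.
rewrite mulf_eq0 expf_eq0 (negPf N0) andbF orbF => k0.
by rewrite k0 l0 in kl.
Qed.

Lemma size_shifted_powers_le (d : nat) (N k l : int) :
  (size (shifted_powers d N k l) <= d.+1)%N.
Proof.
apply: leq_trans (size_polyD _ _) _; rewrite geq_max.
rewrite (leq_trans (size_scale_leq _ _)) ?size_polyXn //=.
rewrite (leq_trans (size_scale_leq _ _)) //.
have -> : N%:P - 'X = - ('X - N%:P) :> {poly int} by rewrite opprB.
by rewrite exprNn -signr_odd size_Msign size_exp_XsubC.
Qed.

Lemma shifted_powers_le (d N J : nat) (k l : int) (x : nat) : (x <= N)%N ->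
  `|k| <= J%:Z -> `|l| <= J%:Z ->
  `|(shifted_powers d N k l).[x]| <= (2 * J * N ^ d)%N%:Z.
Proof.
move=> xN kJ lJ; rewrite horner_shifted_powers.
have NE : N%:Z - x%:Z = (N - x)%N%:Z by lia.
have pow (y : nat) : (y <= N)%N -> `|y%:Z ^+ d| <= (N ^ d)%N%:Z.
  by move=> yN; rewrite -natz -natrX normr_nat natz lez_nat; case: (posnP d) => [->|d0] //; rewrite leq_exp2r.
rewrite NE; apply: le_trans (ler_normD _ _) _.
rewrite -mulnA mulSn mul1n PoszD !normrM.
by apply: lerD; rewrite PoszM; apply: ler_pM => //; rewrite ?pow // leq_subr.
Qed.

(** * A minorant trigonometric polynomial *)

Section Trigonometry.
Variable R : realType.
Implicit Types (x y z t : R) (k l m : int).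

Lemma cos_periodicz x m : cos (x + 2 * pi * m%:~R) = cos x.
Proof.
have pos (n : nat) z : cos (z + 2 * pi * n%:R) = cos z.
  by rewrite mulr_natr mulr_natl; exact: (periodicn (@cosD2pi R)).
case: (intP m) => [|n|n]; first by rewrite mulr0 addr0.
  by rewrite -pmulrn pos.
by rewrite mulrNz mulrN -{2}[x](subrK (2 * pi * n.+1%:R)) pos.
Qed.

Lemma sin_2pi_int m : sin (2 * pi * m%:~R) = 0 :> R.
Proof.
have /eqP : `|cos (2 * pi * m%:~R)| = 1 :> R.
  by rewrite -[_ * _]add0r cos_periodicz cos0 normr1.
by rewrite norm_cos_eq1 => /eqP.
Qed.

(** By the mean value theorem [sin z = z * cos u] with [0 < u < z], and [cos] decreases. *)
Lemma sin_ge_mul_cos z : 0 <= z <= pi / 2 -> z * cos z <= sin z.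
Proof.
move=> /andP[z0 zpi]; have [->|z_neq0] := eqVneq z 0; first by rewrite mul0r sin0.
have z_gt0 : 0 < z by rewrite lt_def z_neq0.
have [u /[!in_itv]/= /andP[u0 uz]] := @MVT R sin cos 0 z z_gt0
  (fun x _ => is_derive_sin x) (continuous_subspaceT (@continuous_sin R)).
rewrite sin0 !subr0 => ->; rewrite mulrC ler_pM2r //.
apply/ltW; rewrite ltr_cos ?in_itv //=; have := pi_gt0 R; lra.
Qed.

(** For [u >= 0] and [z = pi * u / 2], doubling the angle twice gives
    [1 - cos (4 z) = 8 (cos z)^2 (sin z)^2]. Here [(cos z)^2 >= 1/2], since [cos (2 z) >= 0], and
    [sin z >= z cos z >= u cos z]. *)
Lemma one_sub_cos_ge (u : R) : `|u| <= 2^-1 -> 2 * u ^+ 2 <= 1 - cos (2 * pi * u).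
Proof.
have -> : cos (2 * pi * u) = cos (2 * pi * `|u|).
  by rewrite -cos_norm !normrM (ger0_norm (pi_ge0 R)) (@ger0_norm _ 2).
rewrite -(real_normK (num_real u)); move: `|u| (normr_ge0 u) => {}u u0 u12.
have pi2 := pi_ge2 R.
pose z := pi * u / 2.
have -> : 2 * pi * u = (z *+ 2) *+ 2 by rewrite /z; lra.
have z0 : 0 <= z by rewrite /z !mulr_ge0 //; lra.
have zu : u <= z by rewrite /z; nra.
have z4 : z *+ 2 <= pi / 2 by rewrite /z; nra.
have sz : z * cos z <= sin z by apply: sin_ge_mul_cos; lra.
have cz : 0 <= cos (z *+ 2) by apply: cos_ge0_pihalf; lra.
have cz0 : 0 <= cos z by apply: cos_ge0_pihalf; lra.
rewrite cos_mulr2n; have c2 := cos_mulr2n z; have := cos2Dsin2 z.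
move: (cos z) (sin z) (cos (z *+ 2)) sz cz cz0 c2 => c s C sz C0 c0 CE cs.
rewrite CE in C0 *.
have c12 : 2^-1 <= c ^+ 2 by lra.
have su : u ^+ 2 * c ^+ 2 <= s ^+ 2.
  have ucs : u * c <= s by apply: le_trans sz; rewrite ler_wpM2r.
  have uc0 : 0 <= u * c by apply: mulr_ge0.
  by rewrite -exprMn lerXn2r // nnegrE (le_trans uc0).
have -> : 1 - ((c ^+ 2 *+ 2 - 1) ^+ 2 *+ 2 - 1) = 8 * (c ^+ 2 * s ^+ 2).
  have -> : s ^+ 2 = 1 - c ^+ 2 by lra.
  by ring.
have u2 := sqr_ge0 u.
have s2 : 2^-1 * u ^+ 2 <= s ^+ 2 by apply: le_trans su; rewrite mulrC ler_wpM2l.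
have : 2^-1 * (2^-1 * u ^+ 2) <= c ^+ 2 * s ^+ 2 by apply: ler_pM => //; lra.
lra.
Qed.

(** Subtract the nearest integer [m]; comparison with [m + 1] and [m - 1] shows that the remainder
    is at most [1/2] in absolute value. *)
Lemma distZ_sqr_le t : 2 * distZ t ^+ 2 <= 1 - cos (2 * pi * t).
Proof.
have [[m dE] dle] := distZ_min t.
have -> : cos (2 * pi * t) = cos (2 * pi * (t - m%:~R)).
  by rewrite -(cos_periodicz (2 * pi * (t - m%:~R)) m) -mulrDr subrK.
rewrite dE real_normK ?num_real //; apply: one_sub_cos_ge.
have := dle (m + 1); have := dle (m - 1); rewrite dE !intrD.
have -> : t - (m%:~R + 1%:~R) = t - m%:~R - 1 by ring.
have -> : t - (m%:~R + (-1)%:~R) = t - m%:~R + 1 by ring.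
move: (t - m%:~R) => u.
by case: (ger0P u) => u0; case: (ger0P (u - 1)) => u1; case: (ger0P (u + 1)) => u2; lra.
Qed.

(** The squared modulus of [sum_i exp (i f)], expanded in real form; in particular the double sum is
    nonnegative. *)
Lemma sum_cosB (I : finType) (f : I -> R) :
  \sum_i \sum_j cos (f i - f j) = (\sum_i cos (f i)) ^+ 2 + (\sum_i sin (f i)) ^+ 2.
Proof.
rewrite !expr2 !big_distrlr -big_split; apply: eq_bigr => i _ /=.
by rewrite -big_split; apply: eq_bigr => j _; rewrite cosB.
Qed.

(** The sine part of the addition formula is antisymmetric in [i] and [j], so it sums to zero. *)
Lemma sum_cosB_shift (I : finType) (f : I -> R) z :
  \sum_i \sum_j cos (f i - f j + z) = (\sum_i \sum_j cos (f i - f j)) * cos z.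
Proof.
have sin0 : \sum_i \sum_j sin (f i - f j) = 0.
  have S : \sum_i \sum_j sin (f i - f j) = - \sum_i \sum_j sin (f i - f j).
    rewrite {1}exchange_big -sumrN; apply: eq_bigr => i _; rewrite -sumrN.
    by apply: eq_bigr => j _; rewrite -sinN opprB.
  by move: S; lra.
transitivity ((\sum_i \sum_j cos (f i - f j)) * cos z
    - (\sum_i \sum_j sin (f i - f j)) * sin z); last by rewrite sin0 mul0r subr0.
rewrite !mulr_suml -sumrB; apply: eq_bigr => i _.
by rewrite !mulr_suml -sumrB; apply: eq_bigr => j _; rewrite cosD.
Qed.

Lemma sum_pairs_mul (I J : finType) (F : I -> I -> R) (G : J -> J -> R) :
  \sum_(p : (I * J) * (I * J)) F p.1.1 p.2.1 * G p.1.2 p.2.2 =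
  (\sum_i \sum_i' F i i') * (\sum_j \sum_j' G j j').
Proof.
rewrite -(pair_bigA _ (fun a b => F a.1 b.1 * G a.2 b.2)) /=.
rewrite -(pair_bigA _ (fun i j => \sum_b F i b.1 * G j b.2)) /= big_distrlr /=.
apply: eq_bigr => i _; apply: eq_bigr => j _; rewrite big_distrlr /=.
by rewrite -(pair_bigA _ (fun i' j' => F i i' * G j j')).
Qed.

Lemma sum_shifted_diagonal (J : nat) (e : bool) :
  \sum_(i < J) \sum_(j < J) (i + e == j)%N%:R = (J - e)%:R :> R.
Proof.
have sumj (i : nat) : \sum_(j < J) (i + e == j)%N%:R = (i + e < J)%N%:R :> R.
  case: ltnP => iJ; last first.
    by apply: big1 => j _; case: eqP => // ij; move: (ltn_ord j); rewrite -ij ltnNge iJ.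
  rewrite (bigD1 (Ordinal iJ)) //= eqxx big1 ?addr0 // => j jn.
  by case: eqP => // ij; case/eqP: jn; apply: val_inj.
under eq_bigr do rewrite sumj.
case: e {sumj} => /=; last first.
  rewrite subn0; under eq_bigr => i _ do rewrite addn0 ltn_ord.
  by rewrite sumr_const card_ord.
case: J => [|J]; first by rewrite big_ord0.
rewrite big_ord_recr /= addn1 ltnn addr0 subSS subn0.
under eq_bigr => i _ do rewrite addn1 ltnS ltn_ord.
by rewrite sumr_const card_ord.
Qed.

(* [\sum_a \sum_b cos (h a - h b)] over pairs [a, b], with [h a = a.1 * x + a.2 * y],
   is a nonnegative Fejer kernel. Multiplied by [cos x + cos y - 2 + 3 / J]
   it is positive only if both cosines exceed [1 - 3 / J], and its constant
   term is [J]. *)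
Lemma cos_simultaneously_large (I : finType) (J : nat) (x y : I -> R) :
  (0 < #|I|)%N -> (0 < J)%N ->
  (forall k l, (k != 0) || (l != 0) -> `|k| <= J%:Z -> `|l| <= J%:Z ->
    (7 * J ^ 3)%:R * `|\sum_n cos (k%:~R * x n + l%:~R * y n)| <= #|I|%:R) ->
  exists n, 1 - 3 / J%:R < cos (x n) /\ 1 - 3 / J%:R < cos (y n).
Proof.
move=> I0 J0 expsum; pose U := ('I_J * 'I_J)%type; pose T := ('I_3 * (U * U))%type.
have J0' : 0 < J%:R :> R by rewrite ltr0n.
pose th n (a : U) : R := a.1%:R * x n + a.2%:R * y n.
pose FF n := \sum_a \sum_b cos (th n a - th n b).
pose P n := FF n * (cos (x n) + cos (y n) - (2 - 3 / J%:R)).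
have FF_ge0 n : 0 <= FF n by rewrite /FF sum_cosB addr_ge0 ?sqr_ge0.
suff : 0 < \sum_n P n.
  apply: contraPP => /forallNP small; apply/negP; rewrite -leNgt.
  apply: sumr_le0 => n _; rewrite mulr_ge0_le0 //.
  have := cos_le1 (x n); have := cos_le1 (y n).
  have [xn|xn] := lerP (cos (x n)) (1 - 3 / J%:R); first lra.
  have [yn|yn] := lerP (cos (y n)) (1 - 3 / J%:R); first lra.
  by have [] := small n.
(* The index in ['I_3] selects a term of the second factor: [cos x], [cos y] or the constant. Then
   [kk] and [ll] are the frequencies of the expanded product. *)
pose w (s : 'I_3) : R := if (val s == 2)%N then - (2 - 3 / J%:R) else 1.
pose kk (q : T) : int := q.2.1.1%:Z - q.2.2.1%:Z + (val q.1 == 0)%N%:Z.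
pose ll (q : T) : int := q.2.1.2%:Z - q.2.2.2%:Z + (val q.1 == 1)%N%:Z.
pose S q := \sum_n cos ((kk q)%:~R * x n + (ll q)%:~R * y n).
have freqE n (q : T) : (kk q)%:~R * x n + (ll q)%:~R * y n = th n q.2.1 - th n q.2.2
    + ((val q.1 == 0)%N%:R * x n + (val q.1 == 1)%N%:R * y n).
  by rewrite /kk /ll /th !(intrD, intrN) -!pmulrn; ring.
have PE : \sum_n P n = \sum_q w q.1 * S q.
  under [RHS]eq_bigr do rewrite mulr_sumr.
  rewrite exchange_big; apply: eq_bigr => n _ /=.
  under eq_bigr do rewrite freqE.
  rewrite -(pair_bigA _ (fun s p => w s * cos (th n p.1 - th n p.2
    + ((val s == 0)%N%:R * x n + (val s == 1)%N%:R * y n)))) /=.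
  under eq_bigr => s _.
    rewrite -mulr_sumr -(pair_bigA _ (fun a b => cos (th n a - th n b
      + ((val s == 0)%N%:R * x n + (val s == 1)%N%:R * y n)))) /= sum_cosB_shift.
    over.
  rewrite !big_ord_recl big_ord0 /w /= !mul0r !mul1r !addr0 !add0r cos0.
  by rewrite -/(FF n) /P; ring.
pose dg q := (kk q == 0) && (ll q == 0).
(* The three terms contribute [(J - 1) * J], [J * (J - 1)] and [- (2 - 3 / J) * J ^ 2]. *)
have mean : \sum_(q | dg q) w q.1 = J%:R.
  have count2 (e e' : bool) : \sum_(p : U * U)
      ((p.1.1 + e == p.2.1) && (p.1.2 + e' == p.2.2))%N%:R = (J - e)%:R * (J - e')%:R :> R.
    rewrite -!sum_shifted_diagonal -sum_pairs_mul.
    by apply: eq_bigr => p _; rewrite -mulnb natrM.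
  rewrite big_mkcond -(pair_bigA _ (fun s p => if dg (s, p) then w s else 0)) /=.
  under eq_bigr => s _.
    rewrite (eq_bigr (fun p : U * U => w s * ((p.1.1 + (val s == 0) == p.2.1)
      && (p.1.2 + (val s == 1) == p.2.2))%N%:R)); last first.
      move=> p _; rewrite /dg /kk /ll /=.
      have shiftE (a b e : nat) : (a%:Z - b%:Z + e%:Z == 0) = (a + e == b)%N.
        by apply/eqP/eqP; lia.
      by rewrite !shiftE; case: ifP; rewrite ?mulr1 ?mulr0.
    rewrite -mulr_sumr count2.
    over.
  rewrite !big_ord_recl big_ord0 /w /= subn0 subn1 -subn1 natrB //.
  by field; rewrite lt0r_neq0.
rewrite PE (bigID dg) /=.
have -> : \sum_(q | dg q) w q.1 * S q = J%:R * #|I|%:R.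
  rewrite -mean mulr_suml; apply: eq_bigr => q /andP[/eqP k0 /eqP l0].
  rewrite /S k0 l0; under eq_bigr do rewrite !mul0r addr0 cos0.
  by rewrite sumr_const.
have J3_ge0 : 0 <= 3 / J%:R :> R by apply: divr_ge0.
have J3_le3 : 3 / J%:R <= 3 :> R by rewrite ler_pdivrMr // ler_peMr // ler1n.
have w2 s : `|w s| <= 2 by rewrite /w; case: ifP => _; rewrite ler_norml; lra.
have small q : ~~ dg q -> `|w q.1 * S q| <= 2 * (#|I|%:R / (7 * J ^ 3)%:R).
  rewrite negb_and => nz; rewrite normrM; apply: ler_pM => //.
  rewrite ler_pdivlMr ?ltr0n ?muln_gt0 ?expn_gt0 ?J0 // mulrC; apply: expsum => //.
    by rewrite /kk; have := ltn_ord q.2.1.1; have := ltn_ord q.2.2.1; case: eqP; lia.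
  by rewrite /ll; have := ltn_ord q.2.1.2; have := ltn_ord q.2.2.2; case: eqP; lia.
(* At most [3 * J ^ 4] terms, each at most [2 * #|I| / (7 * J ^ 3)]: the 7 in the hypothesis keeps
   them below the main term [J * #|I|]. *)
have : `|\sum_(q | ~~ dg q) w q.1 * S q| <= 6 / 7 * (J%:R * #|I|%:R).
  apply: le_trans (ler_norm_sum _ _ _) _; apply: le_trans (ler_sum _ small) _.
  rewrite sumr_const -[leLHS]mulr_natl; apply: le_trans (_ : (3 * J ^ 4)%:R * _ <= _).
    apply: ler_wpM2r; first by rewrite mulr_ge0 // divr_ge0.
    rewrite ler_nat; apply: leq_trans (max_card _) _.
    by rewrite !card_prod !card_ord !mulnn -expnM.
  rewrite (natrM _ 3) (natrM _ 7) !natrX.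
  have -> : 3 * J%:R ^+ 4 * (2 * (#|I|%:R / (7 * J%:R ^+ 3))) = 6 / 7 * (J%:R * #|I|%:R) :> R.
    by field; rewrite lt0r_neq0.
  by [].
have : 0 < J%:R * #|I|%:R :> R by rewrite mulr_gt0 // ltr0n.
rewrite ler_norml => + /andP[]; lra.
Qed.

End Trigonometry.

(** * Fourth moments *)

Section FourthMoment.
Variable R : realType.
Local Notation mu := (@lebesgue_measure R).
Implicit Types (e m : int) (a : R).

Lemma is_derive_sin_scale a (x : R) : a != 0 ->
  is_derive x 1 (fun y => a^-1 * sin (a * y)) (cos (a * x)).
Proof.
move=> a0.
have da : is_derive x 1 (fun y : R => a * y) a.
  by have := is_deriveZ a (is_derive_id x 1); rewrite /GRing.scale /= mulr1; exact.
have ds := is_derive1_comp (is_derive_sin (a * x)) da.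
have := is_deriveZ a^-1 ds.
by rewrite /GRing.scale /= mulrCA mulVf // mulr1; exact.
Qed.

Lemma continuous_cos_scale a : continuous (fun x : R => cos (a * x)).
Proof.
move=> x; apply: (@continuous_comp _ _ _ (fun y => a * y) (@cos R)).
  exact: mulrl_continuous.
exact: continuous_cos.
Qed.

(** Orthogonality over whole periods: for [e != 0] the antiderivative is a sine that vanishes at
    both integer endpoints. *)
Lemma integral_cos_int (n : nat) e :
  (\int[mu]_(x in `[(- n%:R)%R, (n%:R)%R]) (cos (2 * pi * e%:~R * x))%:E
    = ((e == 0)%:R * (2 * n%:R))%:E)%E.
Proof.
case: (posnP n) => [->|n0].
  by rewrite mulr0n oppr0 set_itv1 integral_set1 !mulr0.
have n0' : 0 < n%:R :> R by rewrite ltr0n.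
have ltn : - n%:R < n%:R :> R by lra.
have [->|e0] := eqVneq e 0.
  under eq_integral do rewrite mulr0 mul0r cos0.
  rewrite integral_cst //= lebesgue_measure_itv /= lte_fin ltn.
  by rewrite mul1r -EFinB mul1e opprK mulr2n mulrDl mul1r.
rewrite mul0r; set a := 2 * pi * e%:~R.
have a0 : a != 0 by rewrite /a !mulf_neq0 ?intr_eq0 // lt0r_neq0 ?pi_gt0.
have dF x := is_derive_sin_scale x a0.
have cF x : {for x, continuous (fun y => a^-1 * sin (a * y))}.
  by apply: differentiable_continuous; apply/derivable1_diffP; have [] := dF x.
rewrite (@continuous_FTC2 _ _ (fun y => a^-1 * sin (a * y))) //.
- have sina : sin (a * n%:R) = 0 by rewrite /a -mulrA (pmulrn _ n) -intrM sin_2pi_int.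
  by rewrite mulrN sinN sina oppr0 mulr0 subee.
- exact/continuous_subspaceT/continuous_cos_scale.
- split; first by move=> x _; have [] := dF x.
  + by apply: cvg_at_right_filter; exact: cF.
  + by apply: cvg_at_left_filter; exact: cF.
- by move=> x _; rewrite derive1E; have [] := dF x.
Qed.

Lemma integral_sum_cos_int (K : finType) (e : K -> int) (n : nat) :
  (\int[mu]_(x in `[(- n%:R)%R, (n%:R)%R]) (\sum_r cos (2 * pi * (e r)%:~R * x))%:E
    = (#|[pred r | e r == 0]|%:R * (2 * n%:R))%:E)%E.
Proof.
under eq_integral do rewrite -sumEFin.
rewrite integral_sum //; last first.
  move=> r; apply: continuous_compact_integrable; first exact: segment_compact.
  exact/continuous_subspaceT/continuous_cos_scale.
under eq_bigr do rewrite integral_cos_int.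
by rewrite sumEFin -mulr_suml -natr_sum sum_bool_count -sum1_count sum1_card.
Qed.

(** The squared modulus of the exponential sum [sum_i e (g i * x)]. *)
Definition exp_sum_sq (I : finType) (g : I -> int) (x : R) : R :=
  (\sum_i cos (2 * pi * (g i)%:~R * x)) ^+ 2 + (\sum_i sin (2 * pi * (g i)%:~R * x)) ^+ 2.

Lemma exp_sum_sqE (I : finType) (g : I -> int) x :
  exp_sum_sq g x = \sum_(p : I * I) cos (2 * pi * (g p.1 - g p.2)%:~R * x).
Proof.
rewrite /exp_sum_sq -sum_cosB pair_bigA; apply: eq_bigr => p _.
by rewrite intrB mulrBr mulrBl.
Qed.

Lemma measurable_exp_sum_sq (I : finType) (g : I -> int) :
  measurable_fun setT (exp_sum_sq g).
Proof.
rewrite (_ : exp_sum_sq g = fun x => \sum_(p : I * I) cos (2 * pi * (g p.1 - g p.2)%:~R * x)).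
  apply: measurable_sum => p; apply: continuous_measurable_fun.
  exact: continuous_cos_scale.
by apply/funext => x; rewrite exp_sum_sqE.
Qed.

Lemma exp_sum_sq_ge0 (I : finType) (g : I -> int) x : 0 <= exp_sum_sq g x.
Proof. by rewrite addr_ge0 ?sqr_ge0. Qed.

Definition large_exp_sum (I : finType) (g : I -> int) (n : nat) (lam : R) : set R :=
  `[- n%:R, n%:R]%classic `&` [set x | lam <= exp_sum_sq g x].

Lemma measurable_large_exp_sum (I : finType) (g : I -> int) (n : nat) (lam : R) :
  measurable (large_exp_sum g n lam).
Proof.
apply: measurableI => //.
have := measurable_exp_sum_sq g measurableT (measurable_itv `[lam, +oo[).
rewrite setTI; congr measurable; apply/seteqP; split => x /=; by rewrite in_itv /= andbT.
Qed.

(** Markov's inequality for the fourth moment, whose integral counts vanishing frequencies. Products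
    of cosines produce both sums and differences of frequencies, hence the two signs [s]. *)
Lemma measure_large_exp_sum (I : finType) (g : I -> int) (n B : nat) (lam : R) :
  0 < lam ->
  (forall s : int, s \in [:: 1; -1] -> (\sum_(p : I * I) #|[pred q : I * I |
     (g q.1 - g q.2 == s * (g p.1 - g p.2))%R]| <= B)%N) ->
  (mu (large_exp_sum g n lam) <= (2 * n%:R * B%:R / lam ^+ 2)%:E)%E.
Proof.
move=> lam0 energy.
(* By the product formula for cosines, [2 * exp_sum_sq g ^+ 2] is the sum [V]
   of the cosines with frequencies [h p + h q] and [h p - h q]. *)
pose K := ((I * I) * (I * I) * bool)%type.
pose h (p : I * I) : int := g p.1 - g p.2.
pose e (r : K) : int := h r.1.1 + (if r.2 then 1 else -1) * h r.1.2.
pose V (x : R) := \sum_r cos (2 * pi * (e r)%:~R * x).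
have VE (x : R) : V x = 2 * exp_sum_sq g x ^+ 2.
  rewrite exp_sum_sqE expr2 big_distrlr /= pair_bigA mulr_sumr /V.
  rewrite -(pair_bigA _ (fun pq b => cos (2 * pi * (h pq.1 + (if b then 1 else -1 : int) * h pq.2)%:~R * x))) /=.
  apply: eq_bigr => pq _; rewrite big_bool /= mul1r mulN1r -/(h pq.1) -/(h pq.2).
  move: (h pq.1) (h pq.2) => u v; rewrite intrD intrB mulrDr mulrDl cosD mulrBr mulrBl cosB; ring.
have cardV : (#|[pred r | e r == 0]| <= 2 * B)%N.
  have -> : #|[pred r | e r == 0]| =
      (\sum_(p : I * I) \sum_(q : I * I) ((h p + h q == 0)%R + (h p - h q == 0)%R))%N.
    rewrite pair_bigA /= -sum1_card big_mkcond /=.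
    rewrite (eq_bigr (fun r => (h r.1.1 + (if r.2 then 1 else -1) * h r.1.2 == 0) : nat)).
      rewrite -(pair_bigA _ (fun pq b =>
        (h pq.1 + (if b then 1 else -1 : int) * h pq.2 == 0) : nat)) /=.
      by apply: eq_bigr => pq _; rewrite big_bool /= mul1r mulN1r.
    by move=> r _; rewrite inE /e; case: ifP.
  rewrite mul2n -addnn; under eq_bigr do rewrite big_split; rewrite big_split /=.
  apply: leq_add.
    apply: leq_trans (energy (-1) _); last by rewrite !inE eqxx orbT.
    apply: leq_sum => p _; rewrite sum_bool_count -sum1_count sum1_card.
    apply/eq_leq/eq_card => q; transitivity (h p + h q == 0); first by [].
    by rewrite !inE /h; apply/eqP/eqP; lia.
  apply: leq_trans (energy 1 _); last by rewrite !inE eqxx.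
  apply: leq_sum => p _; rewrite sum_bool_count -sum1_count sum1_card.
  apply/eq_leq/eq_card => q; transitivity (h p - h q == 0); first by [].
  by rewrite !inE /h; apply/eqP/eqP; lia.
have V0 (x : R) : 0 <= V x by rewrite VE mulr_ge0 // sqr_ge0.
have mV : measurable_fun setT V.
  by apply: measurable_sum => r; apply: continuous_measurable_fun; exact: continuous_cos_scale.
have l2 : 0 < 2 * lam ^+ 2 by rewrite mulr_gt0 // exprn_gt0.
have markov : ((2 * lam ^+ 2)%:E * mu (large_exp_sum g n lam)
    <= \int[mu]_(x in `[(- n%:R)%R, (n%:R)%R]) (V x)%:E)%E.
  pose D : set R := `[- n%:R, n%:R]%classic.
  have mD : measurable D by exact: measurable_itv.
  have := @le_integral_comp_abse _ _ _ mu _ mD (EFin \o V) (2 * lam ^+ 2) id _ _ _ _ l2.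
  have -> : (\int[mu]_(x in D) `|(EFin \o V) x| = \int[mu]_(x in D) (V x)%:E)%E.
    by apply: eq_integral => x _ /=; rewrite ger0_norm.
  have -> : D `&` [set x | ((2 * lam ^+ 2)%:E <= `|(EFin \o V) x|)%E]
      = large_exp_sum g n lam.
    congr setI; apply/seteqP; split => x /=; rewrite ger0_norm // lee_fin VE ler_pM2l //.
      by rewrite ler_pXn2r // nnegrE ?exp_sum_sq_ge0 // ltW.
    by rewrite ler_pXn2r // nnegrE ?exp_sum_sq_ge0 // ltW.
  apply => //.
  by apply/measurable_EFinP; apply: measurable_funS mV.
rewrite -(@lee_pmul2l _ (2 * lam ^+ 2)%:E) //.
apply: le_trans markov _; rewrite integral_sum_cos_int -EFinM lee_fin.
have -> : 2 * lam ^+ 2 * (2 * n%:R * B%:R / lam ^+ 2) = (2 * B)%:R * (2 * n%:R) :> R.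
  by rewrite natrM; field; rewrite lt0r_neq0.
by apply: ler_wpM2r; rewrite ?mulr_ge0 // ler_nat.
Qed.

End FourthMoment.

(** * The exponential sums attached to a given [N] *)

Lemma exists_iroot (e N : nat) : (0 < e)%N -> exists J, (J ^ e <= N < J.+1 ^ e)%N.
Proof.
move=> e0; elim: N => [|N [J /andP[JN NJ]]].
  by exists 0%N; rewrite exp0n // exp1n.
have [NJ'|JN'] := ltnP N.+1 (J.+1 ^ e); first by exists J; rewrite NJ' ltnW.
by exists J.+1; rewrite JN' /= (leq_ltn_trans NJ) // ltn_exp2r.
Qed.

(** The summand is [n = N %/ 3 + i], so that [n] and [N - n] are both at least [N %/ 3] and thus
    large with [N]. *)
Definition phase (d N : nat) (k l : int) (i : 'I_(N %/ 3)) : int :=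
  (shifted_powers d N%:Z k l).[(N %/ 3 + i)%N%:Z].

Definition energy_bound (d C J L : nat) : nat :=
  (L ^ 2 * (2 * (2 * C * J) * d.+1 + d.+1 ^ 2))%N.

(** A nonzero difference is at most [4 * J * N ^ d <= (2 * J) ^ (e * d + 2)], because
    [N <= (2 * J) ^ e]. The divisor bound with exponent [e * d + 2] therefore leaves at most
    [2 * C * J] divisors. *)
Lemma phase_energy_le (d e C J N : nat) (k l s : int) : (3 <= d)%N -> (0 < J)%N ->
  (J ^ e <= N < J.+1 ^ e)%N ->
  (forall v, (0 < v)%N -> (size (divisors v) ^ (e * d + 2) <= C * v)%N) ->
  (k != 0) || (l != 0) -> `|k| <= J%:Z -> `|l| <= J%:Z -> s \in [:: 1; -1] ->
  (\sum_(p : 'I_(N %/ 3) * 'I_(N %/ 3)) #|[pred q : 'I_(N %/ 3) * 'I_(N %/ 3) |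
      (@phase d N k l q.1 - @phase d N k l q.2 == s * (@phase d N k l p.1 - @phase d N k l p.2))%R]|
    <= energy_bound d C J (N %/ 3))%N.
Proof.
move=> d3 J0 /andP[JN NJ] divC kl kJ lJ sE.
pose x (i : 'I_(N %/ 3)) := (N %/ 3 + i)%N%:Z.
have x_inj : injective x by move=> i j [] /addnI/val_inj.
have N0 : N%:Z != 0 by rewrite -lt0n (leq_trans _ JN) // expn_gt0 J0.
have G3 := size_shifted_powers_gt2 d3 N0 kl.
have GD := size_shifted_powers_le d N%:Z k l.
have s0 : s != 0 by move: sE; rewrite !inE => /orP[] /eqP ->.
have s1 : `|s|%N = 1%N by move: sE; rewrite !inE => /orP[] /eqP ->.
have xN (i : 'I_(N %/ 3)) : (N %/ 3 + i <= N)%N.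
  by have := ltn_ord i; have := leq_divM N 3; lia.
have GN i : `|(shifted_powers d N%:Z k l).[x i]| <= (2 * J * N ^ d)%N%:Z.
  exact: shifted_powers_le.
have K0 : (0 < e * d + 2)%N by rewrite addn2.
have C0 : (0 < C)%N by have := divC 1%N isT; rewrite exp1n muln1.
apply: leq_trans (additive_energy_le (T := 2 * C * J) x_inj G3 s0 _) _; last first.
  rewrite card_ord /energy_bound leq_mul2l leq_add ?orbT //.
    by rewrite leq_mul2l GD orbT.
  by rewrite leq_exp2r.
move=> p v0; set v := `|_|%N.
have v_gt0 : (0 < v)%N by rewrite absz_gt0 mulf_neq0.
have vle : (v <= 4 * J * N ^ d)%N.
  rewrite /v abszM s1 mul1n; have := GN p.1; have := GN p.2.
  by move: (_.[_]) (_.[_]) => a b; lia.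
have J2 : (J.+1 <= 2 * J)%N by lia.
rewrite -(leq_exp2r _ _ K0); apply: leq_trans (divC v v_gt0) _.
have -> : (2 * C * J = C * (2 * J))%N by lia.
have J4 : (4 * J <= (2 * J) ^ 2)%N by rewrite expnMn; nia.
rewrite expnMn; apply: leq_mul; first by rewrite -[leqLHS]expn1 leq_pexp2l.
apply: leq_trans vle _; rewrite expnD [leqRHS]mulnC; apply: leq_mul => //.
rewrite expnM.
have NJ2 : (N <= (2 * J) ^ e)%N.
  apply: leq_trans (ltnW NJ) _; case: (posnP e) => [->|e0] //; rewrite leq_exp2r //.
by case: (posnP d) => [->|d0] //; rewrite leq_exp2r.
Qed.

Lemma phase_arg (R : realType) (d N : nat) (k l : int) (i : 'I_(N %/ 3)) (a : R) :
  2 * pi * (phase d k l i)%:~R * a =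
  k%:~R * (2 * pi * (a * (N %/ 3 + i)%:R ^+ d)) +
  l%:~R * (2 * pi * (a * (N - (N %/ 3 + i))%:R ^+ d)).
Proof.
have iN : (N %/ 3 + i <= N)%N by have := ltn_ord i; have := leq_divM N 3; lia.
rewrite /phase horner_shifted_powers natrB // intrD !intrM !rmorphXn /= intrB -!pmulrn.
by ring.
Qed.

Lemma exists_good_summands (R : realType) (d N J : nat) (a : R) :
  (3 <= N)%N -> (0 < J)%N ->
  (forall k l : int, (k != 0) || (l != 0) -> `|k| <= J%:Z -> `|l| <= J%:Z ->
    exp_sum_sq (@phase d N k l) a < ((N %/ 3)%:R / (7 * J ^ 3)%:R) ^+ 2) ->
  exists n, [/\ (N %/ 3 <= n)%N, (N %/ 3 <= N - n)%N, (n <= N)%N,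
    2 * distZ (a * n%:R ^+ d) ^+ 2 < 3 / J%:R &
    2 * distZ (a * (N - n)%:R ^+ d) ^+ 2 < 3 / J%:R].
Proof.
move=> N3 J0 small.
have L0 : (0 < N %/ 3)%N by rewrite divn_gt0.
have c0 : 0 < (7 * J ^ 3)%:R :> R by rewrite ltr0n muln_gt0 expn_gt0 J0.
have [||i [ci ci']] := @cos_simultaneously_large R 'I_(N %/ 3) J
  (fun i => 2 * pi * (a * (N %/ 3 + i)%:R ^+ d))
  (fun i => 2 * pi * (a * (N - (N %/ 3 + i))%:R ^+ d)) _ J0.
- by rewrite card_ord.
- move=> k l kl kJ lJ; rewrite card_ord mulrC -ler_pdivlMr //.
  under eq_bigr do rewrite -phase_arg.
  have lt2 := small k l kl kJ lJ.
  rewrite -(@ler_pXn2r _ 2) ?nnegrE ?divr_ge0 // real_normK ?num_real //.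
  (* The cosine sum is the real part of the exponential sum. *)
  apply: le_trans (ltW lt2); rewrite /exp_sum_sq lerDl; exact: sqr_ge0.
have iN := ltn_ord i; have N3' := leq_divM N 3.
exists (N %/ 3 + i)%N; split; try lia.
- by apply: le_lt_trans (distZ_sqr_le _) _; lra.
- by apply: le_lt_trans (distZ_sqr_le _) _; lra.
Qed.

(** * The exceptional set *)

Section ExceptionalSet.
Variable R : realType.
Local Notation mu := (@lebesgue_measure R).

Lemma measure_bigsetU_le (K : Type) (r : seq K) (P : pred K) (A : K -> set R) (c : R) :
  0 <= c -> (forall q, P q -> measurable (A q)) -> (forall q, P q -> (mu (A q) <= c%:E)%E) ->
  (mu (\big[setU/set0]_(q <- r | P q) A q) <= ((size r)%:R * c)%:E)%E.
Proof.
move=> c0 mA muA; suff [] : measurable (\big[setU/set0]_(q <- r | P q) A q) /\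
  (mu (\big[setU/set0]_(q <- r | P q) A q) <= ((size r)%:R * c)%:E)%E by [].
elim: r => [|q r [mU IHr]]; first by rewrite !big_nil measure0 mul0r.
have step : (mu (\big[setU/set0]_(q <- r | P q) A q) <= ((size (q :: r))%:R * c)%:E)%E.
  by apply: le_trans IHr _; rewrite lee_fin ler_wpM2r // ler_nat /=.
rewrite !big_cons; case: ifP => Pq //; split; first exact: measurableU (mA q Pq) mU.
apply: (le_trans (measureU2 mu (mA q Pq) mU)).
by rewrite /= -natr1 mulrDl mul1r addrC EFinD; apply: leeD => //; exact: muA.
Qed.

(** Subtracting [J] from the ordinals makes the frequencies run over all integers from [-J] to
    [J]. *)
Definition exceptional_set (d N J n : nat) : set R :=
  \big[setU/set0]_(q : 'I_(2 * J).+1 * 'I_(2 * J).+1 |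
      (q.1%:Z - J%:Z != 0) || (q.2%:Z - J%:Z != 0))
    large_exp_sum (@phase d N (q.1%:Z - J%:Z) (q.2%:Z - J%:Z)) n
      (((N %/ 3)%:R / (7 * J ^ 3)%:R) ^+ 2).

Lemma measurable_exceptional_set (d N J n : nat) : measurable (exceptional_set d N J n).
Proof. by apply: bigsetU_measurable => q _; exact: measurable_large_exp_sum. Qed.

Lemma notin_exceptional_set (d N J n : nat) (a : R) : `|a| <= n%:R ->
  ~ exceptional_set d N J n a ->
  forall k l : int, (k != 0) || (l != 0) -> `|k| <= J%:Z -> `|l| <= J%:Z ->
    exp_sum_sq (@phase d N k l) a < ((N %/ 3)%:R / (7 * J ^ 3)%:R) ^+ 2.
Proof.
move=> an nbad k l kl kJ lJ; rewrite ltNge; apply/negP => large; apply: nbad.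
have ord (z : int) : `|z| <= J%:Z -> {i : 'I_(2 * J).+1 | z = i%:Z - J%:Z}.
  move=> zJ; have iJ : (absz (z + J%:Z)%R < (2 * J).+1)%N by lia.
  by exists (Ordinal iJ) => /=; lia.
have [i iE] := ord k kJ; have [j jE] := ord l lJ.
rewrite /exceptional_set (bigD1 (i, j)) /= -?iE -?jE //; left.
by split => //=; rewrite in_itv /= -ler_norml.
Qed.

(** A union bound over at most [9 * J ^ 2] frequency pairs. The energy gives [L ^ 2 * J], the
    threshold gives [7 ^ 4 * J ^ 12 / L ^ 4], and [N <= 5 * L] gives the 25. *)
Lemma measure_exceptional_set (d e C J N n : nat) : (3 <= d)%N -> (3 <= N)%N -> (0 < J)%N ->
  (J ^ e <= N < J.+1 ^ e)%N ->
  (forall v, (0 < v)%N -> (size (divisors v) ^ (e * d + 2) <= C * v)%N) ->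
  (mu (exceptional_set d N J n) <=
    ((9 * 2 * 7 ^ 4 * 25 * n * (4 * C * d.+1 + d.+1 ^ 2))%:R * (J%:R ^+ 15 / N%:R ^+ 2))%:E)%E.
Proof.
move=> d3 N3 J0 JN divC; set L := (N %/ 3)%N.
have L0 : (0 < L)%N by rewrite divn_gt0.
set lam := (L%:R / (7 * J ^ 3)%:R) ^+ 2 : R.
have lam0 : 0 < lam by rewrite exprn_gt0 // divr_gt0 ?ltr0n // muln_gt0 expn_gt0 J0.
pose c : R := 2 * n%:R * (energy_bound d C J L)%:R / lam ^+ 2.
have c0 : 0 <= c by rewrite /c !mulr_ge0 // invr_ge0 exprn_ge0 // ltW.
apply: (@le_trans _ _ ((((2 * J).+1 ^ 2)%:R * c)%:E)%E).
  have -> : ((2 * J).+1 ^ 2)%N = size (index_enum ('I_(2 * J).+1 * 'I_(2 * J).+1)%type).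
    by rewrite -sum1_size sum1_card card_prod card_ord.
  apply: measure_bigsetU_le => // [q _|q nz]; first exact: measurable_large_exp_sum.
  apply: measure_large_exp_sum => // s sE.
  have absJ (a : nat) : (a < (2 * J).+1)%N -> `|a%:Z - J%:Z| <= J%:Z by lia.
  by apply: (phase_energy_le d3 J0 JN divC nz _ _ sE); apply: absJ; exact: ltn_ord.
rewrite lee_fin /c /lam.
have J0' : 0 < J%:R :> R by rewrite ltr0n.
have L0' : 0 < L%:R :> R by rewrite ltr0n.
have N0 : 0 < N%:R :> R by rewrite ltr0n; lia.
have NL : N%:R <= 5 * L%:R :> R.
  by rewrite -natrM ler_nat; have := divn_eq N 3; have := ltn_pmod N (isT : 0 < 3)%N; rewrite -/L; lia.
set D := (4 * C * d.+1 + d.+1 ^ 2)%N.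
have BE : (energy_bound d C J L)%:R <= L%:R ^+ 2 * (J%:R * D%:R) :> R.
  rewrite -natrX -!natrM ler_nat /energy_bound leq_mul2l; apply/orP; right.
  by rewrite /D mulnDr; apply: leq_add; [lia | exact: leq_pmull].
have J9 : ((2 * J).+1 ^ 2)%:R <= 9 * J%:R ^+ 2 :> R.
  by rewrite -natrX -natrM ler_nat; nia.
have NL2 : (L%:R ^+ 2)^-1 <= 25 / N%:R ^+ 2 :> R.
  rewrite ler_pdivlMr ?exprn_gt0 // mulrC ler_pdivrMr ?exprn_gt0 //.
  by nra.
apply: (@le_trans _ _ ((9 * J%:R ^+ 2) * (2 * n%:R * (L%:R ^+ 2 * (J%:R * D%:R)) /
    ((L%:R / (7 * J ^ 3)%:R) ^+ 2) ^+ 2))).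
  apply: ler_pM => //; rewrite ler_wpM2r ?invr_ge0 ?exprn_ge0 ?sqr_ge0 //.
  by rewrite ler_wpM2l // mulr_ge0.
have -> : (9 * J%:R ^+ 2) * (2 * n%:R * (L%:R ^+ 2 * (J%:R * D%:R)) /
    ((L%:R / (7 * J ^ 3)%:R) ^+ 2) ^+ 2) =
    (9 * 2 * 7 ^+ 4 * n%:R * D%:R * J%:R ^+ 15) * (L%:R ^+ 2)^-1 :> R.
  by rewrite natrM natrX; field; rewrite !lt0r_neq0.
apply: (@le_trans _ _ ((9 * 2 * 7 ^+ 4 * n%:R * D%:R * J%:R ^+ 15) * (25 / N%:R ^+ 2))).
  by rewrite ler_wpM2l // !mulr_ge0 ?exprn_ge0 // ltW.
rewrite (natrM _ _ D) (natrM _ _ n) (natrM _ _ 25) (natrM _ _ (7 ^ 4)) (natrM _ 9) natrX.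
by apply/eqP/eqP; rewrite le_eqVlt; apply/orP; left; apply/eqP; ring.
Qed.

(* The right-hand side is comparable to [N^(-3/2)] and its sum over [N] telescopes. *)
Lemma pow15_div_sqr_le_telescope (N : nat) (J : nat) : (2 <= N)%N -> (J ^ 30 <= N)%N ->
  J%:R ^+ 15 / N%:R ^+ 2 <= 2 * ((Num.sqrt N.-1%:R)^-1 - (Num.sqrt N%:R)^-1) :> R.
Proof.
move=> N2 JN; set s := Num.sqrt N%:R; set t := Num.sqrt N.-1%:R.
have t0 : 0 < t by rewrite sqrtr_gt0 ltr0n; lia.
have s0 : 0 < s by rewrite sqrtr_gt0 ltr0n; lia.
have s2 : s ^+ 2 = N%:R by rewrite sqr_sqrtr.
have t2 : t ^+ 2 = N%:R - 1 by rewrite sqr_sqrtr // -subn1 natrB //; lia.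
have ts : t <= s by rewrite ler_sqrt // ler_nat; lia.
have Js : J%:R ^+ 15 <= s.
  rewrite -(@ler_pXn2r _ 2) ?nnegrE ?exprn_ge0 ?(ltW s0) // s2 -exprM.
  by have : (J ^ 30)%:R <= N%:R :> R; [rewrite ler_nat | rewrite natrX].
apply: (@le_trans _ _ (s / N%:R ^+ 2)).
  by rewrite ler_wpM2r // invr_ge0 exprn_ge0.
rewrite -s2.
have -> : s / (s ^+ 2) ^+ 2 = (s * s * s)^-1 by field; rewrite lt0r_neq0.
have -> : 2 * (t^-1 - s^-1) = 2 * ((s ^+ 2 - t ^+ 2) / (t * s * (s + t))).
  by field; rewrite !lt0r_neq0 // addr_gt0.
have -> : s ^+ 2 - t ^+ 2 = 1 by rewrite s2 t2; ring.
rewrite mul1r -[X in X <= _]mul1r ler_pdivrMr ?mulr_gt0 // mulrAC.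
rewrite ler_pdivlMr ?mulr_gt0 ?addr_gt0 // mul1r.
have : t * s * (s + t) <= s * s * (s + s).
  by apply: ler_pM; rewrite ?mulr_ge0 ?addr_ge0 ?ler_pM2r ?lerD2l // ltW.
lra.
Qed.

End ExceptionalSet.

(** * Borel-Cantelli and the conclusion *)

Lemma lim_sup_set_measure0 (R : realType) (F : (set R)^nat) (K : R) (b : nat -> R) :
  (forall k, measurable (F k)) -> 0 <= K -> (forall k, 0 <= b k) ->
  (forall k, (@lebesgue_measure R (F k) <= (K * (b k - b k.+1))%:E)%E) ->
  @lebesgue_measure R (lim_sup_set F) = 0%E.
Proof.
move=> mF K0 b0 muF; apply: lim_sup_set_cvg0 => //.
apply: (@le_lt_trans _ _ (K * b 0%N)%:E); last exact: ltry.
apply: lime_le; first by apply: is_cvg_nneseries => k _ _; exact: measure_ge0.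
apply: nearW => n.
apply: (@le_trans _ _ (\sum_(0 <= k < n) (K * (b k - b k.+1))%:E)%E).
  by apply: lee_sum => k _; exact: muF.
rewrite sumEFin lee_fin -mulr_sumr ler_wpM2l //.
have -> : \sum_(0 <= k < n) (b k - b k.+1) = b 0%N - b n.
  elim: n => [|n IHn]; first by rewrite big_nil subrr.
  by rewrite big_nat_recr //= IHn addrA subrK.
by rewrite gerBl.
Qed.

(** The ratio of logarithms is eventually below [1 / M], that is, [eps n > n^(-1/M)]. *)
Lemma subpolynomial_lower_bound (R : realType) (eps : nat -> R) (M : nat) :
  (0 < M)%N -> (forall n, 0 < eps n) ->
  (fun n : nat => ln (1 / eps n) / ln n%:R) @ \oo --> (0 : R) ->
  exists n1 : nat, forall n, (n1 <= n)%N -> 1 < eps n ^+ M * n%:R.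
Proof.
move=> M0 eps0 cvg; have M0' : 0 < M%:R :> R by rewrite ltr0n.
have : \forall n \near \oo, ln (1 / eps n) / ln n%:R < M%:R^-1.
  by apply: (cvgr_lt (0 : R) cvg); rewrite invr_gt0.
case=> n1 _ small; exists (maxn n1 2) => n; rewrite geq_max => /andP[n1n n2].
have n0 : 0 < n%:R :> R by rewrite ltr0n; lia.
have lnn : 0 < ln n%:R :> R by apply: ln_gt0; rewrite ltr1n.
have := small n n1n; rewrite /= div1r lnV ?posrE // ltr_pdivrMr // ltr_pdivlMl // => lt.
rewrite ltNge; apply/negP => /ln_le0; rewrite lnM ?posrE ?exprn_gt0 // lnXn //.
by rewrite -[_ *+ M]mulr_natl; lra.
Qed.

(* If [eps < distZ t], then [eps ^+ 2 <= 3 / (2 J)] and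
   [eps ^+ 120 * n <= (3 / (2 J)) ^+ 60 * (2 J) ^+ 30 = (9 / (2 J)) ^+ 30 <= 1]. *)
Lemma distZ_le_of_lower_bound (R : realType) (t eps : R) (n J : nat) : 0 < eps -> (5 <= J)%N ->
  (n <= (2 * J) ^ 30)%N -> 1 < eps ^+ 120 * n%:R -> 2 * distZ t ^+ 2 < 3 / J%:R ->
  distZ t <= eps.
Proof.
move=> eps0 J5 nJ epsn dist; rewrite leNgt; apply/negP => lt.
have J0 : 0 < J%:R :> R by rewrite ltr0n; lia.
have eps2 : eps ^+ 2 <= 3 / (2 * J%:R).
  have -> : 3 / (2 * J%:R) = 3 / J%:R / 2 :> R by field; rewrite lt0r_neq0.
  have : eps ^+ 2 <= distZ t ^+ 2 by rewrite ler_pXn2r // ?nnegrE ltW // (lt_trans eps0).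
  by lra.
have nJ' : n%:R <= (2 * J%:R) ^+ 30 :> R by rewrite -natrM -natrX ler_nat.
have : eps ^+ 120 * n%:R <= 1.
  rewrite (_ : eps ^+ 120 = ((eps ^+ 2) ^+ 2) ^+ 30); last by rewrite -!exprM.
  apply: (@le_trans _ _ (((3 / (2 * J%:R)) ^+ 2) ^+ 30 * (2 * J%:R) ^+ 30)).
    apply: ler_pM => //; first by rewrite !exprn_ge0 // ltW.
    by rewrite !ler_pXn2r // ?nnegrE ?exprn_ge0 ?divr_ge0 ?mulr_ge0 // ltW.
  rewrite -exprMn.
  have -> : (3 / (2 * J%:R)) ^+ 2 * (2 * J%:R) = 9 / (2 * J%:R) :> R.
    by field; rewrite lt0r_neq0.
  apply: exprn_ile1; first by rewrite divr_ge0 ?mulr_ge0.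
  rewrite ler_pdivrMr ?mul1r ?mulr_gt0 // -natrM ler_nat; lia.
by rewrite leNgt epsn.
Qed.

Theorem mainTheorem3 (R : realType) (d : nat) (hd : (3 <= d)%N) :
  exists Z : set R, (@lebesgue_measure R).-negligible Z /\
    forall eps : nat -> R,
      (forall n : nat, 0 < eps n) ->
      (fun n : nat => ln (1 / eps n) / ln n%:R) @ \oo --> (0 : R) ->
      forall alpha : R, ~ Z alpha ->
        basis_of_order2 [set n : nat | distZ (alpha * n%:R ^+ d) <= eps n].
Proof.
have /choice[J JP] : forall N, exists J, (J ^ 30 <= N < J.+1 ^ 30)%N.
  by move=> N; exact: exists_iroot.
have Jge (b N : nat) : (b ^ 30 <= N)%N -> (b <= J N)%N.
  have /andP[_ NJ] := JP N => bN.
  by rewrite -ltnS -(@ltn_exp2r _ _ 30) // (leq_ltn_trans bN).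
(* The shift by 3 keeps [N %/ 3] positive; [n] bounds the window containing [alpha], and the union
   over [n] covers the line. *)
pose F n k : set R := exceptional_set d k.+3 (J k.+3) n.
exists (\bigcup_n lim_sup_set (F n)); split.
  apply: negligible_bigcup => n; apply/negligibleP.
    apply: bigcap_measurable => // k _; apply: bigcup_measurable => j _.
    exact: measurable_exceptional_set.
  have [C _ divC] := size_divisors_bound (isT : 0 < (30 * d).+2)%N.
  pose K : R := (9 * 2 * 7 ^ 4 * 25 * n * (4 * C * d.+1 + d.+1 ^ 2))%:R * 2.
  apply: (@lim_sup_set_measure0 _ _ K (fun k => (Num.sqrt k.+2%:R)^-1)) => [k|||k].
  - exact: measurable_exceptional_set.
  - by rewrite /K mulr_ge0.
  - by move=> k; rewrite invr_ge0 sqrtr_ge0.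
  have J0 : (0 < J k.+3)%N by apply: Jge; rewrite exp1n.
  apply: le_trans (measure_exceptional_set _ n hd _ J0 (JP k.+3) _) _ => //.
    by move=> v v0; rewrite addn2; exact: divC.
  rewrite lee_fin /K -mulrA ler_wpM2l //; apply: pow15_div_sqr_le_telescope => //.
  by have /andP[] := JP k.+3.
move=> eps eps0 epsP alpha nZ.
(* Good summands have distance [O (N^(-1/60))]; the exponent 120 leaves room to absorb the
   constants. *)
have [n1 n1P] := subpolynomial_lower_bound (isT : 0 < 120)%N eps0 epsP.
have [n an] : exists n : nat, `|alpha| <= n%:R.
  by exists (Num.bound `|alpha|); exact/ltW/archi_boundP.
have [n2 n2P] : exists n2, forall k, (n2 <= k)%N -> ~ F n k alpha.
  apply: contrapT => /forallNP no; apply: nZ; exists n => // k _.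
  have /existsNP[j /not_implyP[kj /contrapT Fj]] := no k.
  by exists j.
have [b bP] : exists b, forall N, (b <= N)%N -> (5 <= J N)%N.
  by exists (5 ^ 30)%N => N; exact: Jge.
(* [n2.+3] places [N] beyond the exceptional sets containing [alpha], [b] ensures [5 <= J N], and
   [3 * n1] makes both summands at least [n1]. *)
exists (n2.+3 + b + 3 * n1)%N => // N /= Nge.
have N3 : (3 <= N)%N by lia.
have J5 : (5 <= J N)%N by apply: bP; lia.
have J0 : (0 < J N)%N by lia.
have nF : ~ exceptional_set d N (J N) n alpha.
  have NE : (N - 3).+3 = N by lia.
  by have := n2P (N - 3)%N; rewrite /F NE; apply; lia.
have [m [m1 m2 mN dm dNm]] := exists_good_summands N3 J0 (notin_exceptional_set an nF).
have n1L : (n1 <= N %/ 3)%N by rewrite leq_divRL //; lia.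
have NJ : (N <= (2 * J N) ^ 30)%N.
  have /andP[_ NJ] := JP N; apply: leq_trans (ltnW NJ) _.
  by rewrite leq_exp2r //; lia.
exists m; first apply: (distZ_le_of_lower_bound (n := m)) dm => //.
- exact: leq_trans mN NJ.
- by apply: n1P; exact: leq_trans m1.
exists (N - m)%N; last exact: subnKC.
apply: (distZ_le_of_lower_bound (n := N - m)) dNm => //.
- by apply: leq_trans NJ; exact: leq_subr.
- by apply: n1P; exact: leq_trans m2.
Qed.
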